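(* Let $n\ge1$. Every additive finite free affine algebraic set $\mathcal{V}\subseteq\mathcal{M}_n$ is of finite additive finite free rank, with $\displaystyle \mathrm{ark}(\mathcal{V})\le\sum_{k=1}^{n-1}k!\binom{n}{k}^2$.
   Context: $\mathcal{M}_n=\mathbb{C}^{n\times n}$ and $\chi_A(x)=\det(xI-A)$. For polynomials $p(x)=\sum_{k=0}^n a_kx^{n-k}$ and $q(x)=\sum_{k=0}^n b_kx^{n-k}$ of degree $n$ over $\mathbb{C}$, the additive convolution is $p(x)\boxplus q(x)=\sum_{k=0}^n\Big(\sum_{i+j=k}\frac{\binom{n-i}{j}}{\binom{n}{j}}a_ib_j\Big)x^{n-k}$. Matrices $A,B\in\mathcal{M}_n$ are in additive finite free position (additive FFP) if $\chi_{A+B}(x)=\chi_A(x)\boxplus\chi_B(x)$. For $\mathcal{A}\subseteq\mathcal{M}_n$, $\mathcal{A}^{\boxplus}$ is the set of all $B\in\mathcal{M}_n$ that are in additive FFP with every $A\in\mathcal{A}$, and $\mathcal{A}^{\boxplus\boxplus}=(\mathcal{A}^{\boxplus})^{\boxplus}$. An additive finite free affine algebraic set is a set of the form $\mathcal{A}^{\boxplus}$ for some $\mathcal{A}\subseteq\mathcal{M}_n$; every such $\mathcal{V}$ satisfies $\mathcal{V}=\mathcal{V}^{\boxplus\boxplus}$. A set $\mathcal{A}\subseteq\mathcal{M}_n$ is a generating set of $\mathcal{V}$ if $\mathcal{V}=\mathcal{A}^{\boxplus\boxplus}$. The additive finite free rank $\mathrm{ark}(\mathcal{V})$ is the minimal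 cardinality of a generating set of $\mathcal{V}$. *)

(* Defs.v *)
From HB Require Import structures.
From mathcomp Require Import all_boot all_order all_algebra.
From mathcomp Require Import all_classical all_reals.
From mathcomp Require Export complex.

Set Implicit Arguments.
Unset Strict Implicit.
Unset Printing Implicit Defensive.

Import Order.TTheory GRing.Theory Num.Theory.

Local Open Scope classical_set_scope.
Local Open Scope card_scope.
Local Open Scope ring_scope.

(* The complex numbers are R[i] with R : realType. *)

(* In p = \sum_k a_k x^(n-k), the coefficient a_k is p`_(n - k). *)
Definition add_conv (R : realType) (n : nat) (p q : {poly R[i]}) : {poly R[i]} :=
  \sum_(k < n.+1)
    (\sum_(i < n.+1) \sum_(j < n.+1 | (i + j == k)%N)
        ('C(n - i, j)%:R / 'C(n, j)%:R) * p`_(n - i) * q`_(n - j))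
      *: 'X^(n - k).

Definition add_FFP (R : realType) (n : nat) (A B : 'M[R[i]]_n) : Prop :=
  char_poly (A + B) = add_conv n (char_poly A) (char_poly B).

Definition add_FFP_set (R : realType) (n : nat) (S : set 'M[R[i]]_n) :
    set 'M[R[i]]_n :=
  [set B | forall A, S A -> add_FFP A B].

Definition add_FF_affine_algebraic (R : realType) (n : nat)
    (V : set 'M[R[i]]_n) : Prop :=
  exists S : set 'M[R[i]]_n, V = add_FFP_set S.

Definition generating_set (R : realType) (n : nat) (V S : set 'M[R[i]]_n) : Prop :=
  V = add_FFP_set (add_FFP_set S).

(* [is_ark V r]: V has finite additive finite free rank, equal to r.  The
   minimum is over all generating sets, finite or infinite. *)
Definition is_ark (R : realType) (n : nat) (V : set 'M[R[i]]_n) (r : nat) : Prop :=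
  (exists2 S : set 'M[R[i]]_n, generating_set V S & S #= `I_r) /\
  (forall S : set 'M[R[i]]_n, generating_set V S -> `I_r #<= S).

(* Main.v *)
From HB Require Import structures.
Require Import Defs.
From mathcomp Require Import all_boot all_order all_fingroup all_algebra.
From mathcomp Require Import all_classical all_reals.
From mathcomp Require Import zify ring.

(** For a fixed matrix B, being in additive finite free position with B is a
linear condition on a vector of monomials in the entries of A, and the number
of these monomials is at most the bound of the theorem.

Expand the determinant chi_(A+B) by splitting each factor of the Leibniz
formula into its A-part and its (x - B)-part.  This writes chi_(A+B) as a sum
over pairs (I, s), I a set of rows and s a permutation, of the monomial
prod_(i in I) (- A i (s i)) times a polynomial depending on B only.  The
monomial depends on s only through its restriction to I, which is a partial
permutation; there are k! C(n,k)^2 of them with domain of size k.  The two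
extreme domains contribute chi_B (I empty) and det (- A) (I full), see
[char_polyD].  With B = 0 the same expansion describes chi_A, and since the
convolution is linear in its first argument, has unit X^n and sends (c, q) to c
for a constant c and a monic q of degree n, chi_A [+] chi_B contains the same two extreme terms.  They cancel,
and what is left of the equation chi_(A+B) = chi_A [+] chi_B is homogeneous
linear in the monomials of the partial permutations with domain of size
1, ..., n-1 ([add_FFP_monomial]).

Hence the matrices in finite free position with all of V are already determined
by a finite subset of V whose monomial vectors span those of V
([finite_generating_set]): that subset generates V, because V, being closed,
generates itself.  As finite generating sets exist, the least size of one is the
rank, and infinite generating sets cannot do better ([is_ark_le]). *)

Set Implicit Arguments.
Unset Strict Implicit.
Unset Printing Implicit Defensive.

Import Order.TTheory GRing.Theory Num.Theory.

Local Open Scope classical_set_scope.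
Local Open Scope card_scope.
Local Open Scope ring_scope.

(** * Counting partial permutations *)

(** The restriction of [s] to [I], stored with its domain; outside [I] the
function is filled in by the identity so that two permutations that agree on
[I] give equal pairs. *)
Definition partial_perm n (I : {set 'I_n}) (s : 'S_n) :
    {set 'I_n} * {ffun 'I_n -> 'I_n} :=
  (I, [ffun i => if i \in I then s i else i]).

Definition proper_domain n (I : {set 'I_n}) : bool := (0 < #|I| < n)%N.

Definition proper_partial_perms n : {set {set 'I_n} * {ffun 'I_n -> 'I_n}} :=
  [set partial_perm u.1 u.2 |
    u in [set u : {set 'I_n} * 'S_n | proper_domain u.1]]%SET.

(** A restriction to [I] is determined by the tuple of its values along an
enumeration of [I], which has no repetition. *)
Lemma card_partial_perms_on n (I : {set 'I_n}) :
  (#|[set (partial_perm I s).2 | s : 'S_n]%SET| <= (#|I|)`! * 'C(n, #|I|))%N.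
Proof.
rewrite mulnC bin_ffact.
pose values (g : {ffun 'I_n -> 'I_n}) := [tuple of map g (enum_tuple I)].
have -> : (n ^_ #|I| = #|[set t : #|I|.-tuple 'I_n | all [in predT] t & uniq t]|)%N.
  by rewrite (card_uniq_tuples #|I| predT) card_ord.
rewrite -(@card_in_imset _ _ values); last first.
  move=> _ _ /imsetP[s _ ->] /imsetP[t _ ->] /(congr1 val) /= /eq_in_map eq_st.
  apply/ffunP => i; have := eq_st i; rewrite !ffunE mem_enum.
  by case: ifP => // _; apply.
apply/subset_leq_card/fintype.subsetP => _ /imsetP[_ /imsetP[s _ ->] ->].
rewrite inE; apply/andP; split; first exact/allP.
rewrite map_inj_in_uniq ?enum_uniq // => i j.
by rewrite !mem_enum !ffunE => -> -> /perm_inj.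
Qed.

Lemma card_proper_partial_perms n :
  (#|proper_partial_perms n| <= \sum_(1 <= k < n) k`! * 'C(n, k) ^ 2)%N.
Proof.
rewrite -sum1_card (partition_big fst (@proper_domain n)) /=; last first.
  by move=> p /imsetP[[I s]]; rewrite inE /= => ? ->.
have fiber_le (I : {set 'I_n}) : proper_domain I ->
    (\sum_(p in proper_partial_perms n | p.1 == I) 1 <= (#|I|)`! * 'C(n, #|I|))%N.
  move=> _; apply: leq_trans (card_partial_perms_on I).
  rewrite sum1dep_card -(@card_in_imset _ _ snd); last first.
    move=> [I1 g] [I2 h]; rewrite !inE /= => /andP[_ /eqP->] /andP[_ /eqP->].
    by move=> ->.
  apply/subset_leq_card/fintype.subsetP => _ /imsetP[[J g] + ->].
  rewrite inE => /andP[/imsetP[[K s] _ [-> ->]] /eqP /= <-].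
  exact: imset_f.
apply: leq_trans (leq_sum _ fiber_le) _.
have expand_square (k : nat) :
    (k`! * 'C(n, k) ^ 2 = \sum_(I : {set 'I_n} | #|I| == k) k`! * 'C(n, k))%N.
  rewrite sum_nat_cond_const -mulnn mulnA mulnC; congr (_ * _)%N.
  by rewrite card_draws card_ord.
rewrite [X in (_ <= X)%N](eq_bigr _ (fun k _ => expand_square k)).
rewrite [X in (_ <= X)%N]big_nat_cond.
rewrite (exchange_big_dep (@proper_domain n)) /=; last first.
  by move=> k I; rewrite andbT => k_range /eqP card_I; rewrite /proper_domain card_I.
apply: leq_sum => I propI.
rewrite [X in (_ <= X)%N]big_mkcond (bigD1_seq #|I|) ?iota_uniq //=;
  last by rewrite mem_index_iota.
by move: (propI); rewrite /proper_domain => ->; rewrite eqxx leq_addr.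
Qed.

(** * Spanning subfamilies *)

Lemma linear_eq0_span (K : fieldType) (vT : vectType K) (W : lmodType K)
    (f : vT -> W) (X : seq vT) (v : vT) :
  linear f -> {in X, forall x, f x = 0} -> v \in <<X>>%VS -> f v = 0.
Proof.
move=> f_linear fX0.
pose g : {linear vT -> W} := HB.pack f (GRing.isLinear.Build K vT W *:%R f f_linear).
move=> /(@coord_span _ _ _ (in_tuple X)) ->; rewrite -[f]/(g : vT -> W) linear_sum.
by rewrite big1// => i _; rewrite linearZ /= fX0 ?scaler0 ?mem_nth.
Qed.

(** Among the sequences in [V] with linearly independent images, whose length is
bounded by the dimension, one of maximal length has a spanning image. *)
Lemma spanning_subset (K : fieldType) (vT : vectType K) (T : eqType)
    (m : T -> vT) (V : set T) :
  exists s : seq T, [/\ (size s <= \dim {:vT})%N, [set` s] `<=` V &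
    forall x, V x -> m x \in <<map m s>>%VS].
Proof.
pose free_in_V k := `[< exists s : seq T,
  [/\ size s = k, [set` s] `<=` V & free (map m s)] >].
have free_in_V_le k : free_in_V k -> (k <= \dim {:vT})%N.
  case/asboolP => s [<- _]; rewrite /free size_map => /eqP <-.
  exact/dimvS/subvf.
have free_in_V0 : exists k, free_in_V k.
  by exists 0%N; apply/asboolP; exists [::]; split; rewrite ?nil_free.
case: (ex_maxnP free_in_V0 free_in_V_le) => k /[dup] /free_in_V_le k_le.
case/asboolP => s [size_s sV s_free] k_max.
exists s; split; rewrite ?size_s// => x Vx; apply: contraT => x_out.
suff /k_max : free_in_V k.+1 by rewrite ltnn.
apply/asboolP; exists (x :: s); split; rewrite /= ?size_s ?free_cons ?x_out//.
by move=> y /=; rewrite inE => /orP[/eqP->//|]; apply: sV.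
Qed.

(** * The additive convolution *)

Section AdditiveConvolution.
Variables (R : realType) (n : nat).
Implicit Types p q : {poly R[i]}.

Lemma add_convD q : {morph (fun p => add_conv n p q) : p1 p2 / p1 + p2}.
Proof.
move=> p1 p2; rewrite /add_conv -big_split /=; apply: eq_bigr => k _.
rewrite -scalerDl -big_split /=; congr (_ *: _); apply: eq_bigr => i _.
rewrite -big_split /=; apply: eq_bigr => j _.
by rewrite coefD mulrDr mulrDl.
Qed.

Lemma add_convZ q a p : add_conv n (a *: p) q = a *: add_conv n p q.
Proof.
rewrite /add_conv scaler_sumr; apply: eq_bigr => k _.
rewrite scalerA mulr_sumr; congr (_ *: _); apply: eq_bigr => i _.
rewrite mulr_sumr; apply: eq_bigr => j _.
by rewrite coefZ (mulrCA _ a) !mulrA.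
Qed.

Lemma add_conv_sum q (I : finType) (P : pred I) (F : I -> {poly R[i]}) :
  add_conv n (\sum_(i | P i) F i) q = \sum_(i | P i) add_conv n (F i) q.
Proof.
apply: (big_morph (fun p => add_conv n p q)); first exact: add_convD.
by have := add_convZ q 0 0; rewrite !scale0r.
Qed.

(** Either order of choosing disjoint subsets of sizes [i] and [j] counts the same
multinomial number. *)
Lemma mul_bin_fact i j : (i + j <= n)%N ->
  ('C(n, i) * 'C(n - i, j) * (i`! * j`! * (n - (i + j))`!) = n`!)%N.
Proof.
move=> ij_le.
have i_le : (i <= n)%N by exact: leq_trans (leq_addr _ _) ij_le.
have j_le : (j <= n - i)%N by rewrite leq_subRL.
rewrite -(bin_fact i_le) -(bin_fact j_le) -subnDA; ring.
Qed.

Lemma bin_ratioC i j : (i + j <= n)%N ->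
  'C(n - i, j)%:R / 'C(n, j)%:R = 'C(n - j, i)%:R / 'C(n, i)%:R :> R[i].
Proof.
move=> ij_le.
have nz k : (k <= n)%N -> 'C(n, k)%:R != 0 :> R[i].
  by move=> k_le; rewrite pnatr_eq0 -lt0n bin_gt0.
apply/eqP; rewrite eqr_div ?nz//; [|lia..].
rewrite -!natrM eqr_nat mulnC [X in _ == X]mulnC.
rewrite -(@eqn_pmul2r (i`! * j`! * (n - (i + j))`!)) ?muln_gt0 ?fact_gt0//.
have ji_le : (j + i <= n)%N by rewrite addnC.
by rewrite mul_bin_fact// -(mul_bin_fact ji_le) (addnC j) (mulnC j`!).
Qed.

Lemma add_convC p q : add_conv n p q = add_conv n q p.
Proof.
rewrite /add_conv; apply: eq_bigr => k _; congr (_ *: _).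
rewrite (exchange_big_dep predT) //=; apply: eq_bigr => i _.
apply: eq_big => [j|j /eqP ij]; first by rewrite addnC.
rewrite bin_ratioC; last by rewrite ij -ltnS.
by rewrite mulrAC.
Qed.

(** Only the index [i = 0] survives, with the coefficient ratio
[C(n, k) / C(n, k) = 1]. *)
Lemma add_conv_Xn q : (size q <= n.+1)%N -> add_conv n 'X^n q = q.
Proof.
move=> size_q; transitivity (\sum_(k < n.+1) q`_(n - k) *: 'X^(n - k)).
  apply: eq_bigr => k _; congr (_ *: _).
  rewrite (bigD1 ord0) //= [X in _ + X]big1 ?addr0; last first.
    move=> i i_neq0; apply: big1 => j _.
    have i_gt0 : (0 < i)%N by rewrite lt0n.
    by rewrite coefXn ltn_eqF ?mulr0 ?mul0r//; have := ltn_ord i; lia.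
  rewrite (big_pred1 k) /= => [|j]; last by rewrite add0n.
  rewrite subn0 coefXn eqxx mulr1 divff ?mul1r//.
  by rewrite pnatr_eq0 -lt0n bin_gt0 -ltnS.
rewrite (reindex_inj rev_ord_inj) /=.
apply/polyP => k; rewrite coef_sum.
under eq_bigr => i _ do rewrite coefZ coefXn subSS subKn ?leq_ord //.
have [k_lt|k_ge] := ltnP k n.+1.
  rewrite (bigD1 (Ordinal k_lt)) //= eqxx mulr1 big1 ?addr0// => i.
  by rewrite -val_eqE /= eq_sym => /negPf->; rewrite mulr0.
rewrite nth_default ?(leq_trans size_q)// big1// => i _.
by rewrite gtn_eqF ?mulr0// (leq_trans (ltn_ord i)).
Qed.

(** Only [i = n] survives, which forces [j = 0] and [k = n]. *)
Lemma add_conv_polyC a q : q`_n = 1 -> add_conv n a%:P q = a%:P.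
Proof.
move=> q_n; rewrite /add_conv (bigD1 ord_max) //= [X in _ + X]big1 ?addr0; last first.
  move=> k k_neq.
  rewrite big1 ?scale0r// => i _; apply: big1 => j /eqP ijk.
  rewrite coefC ifF ?mulr0 ?mul0r//; apply/negbTE; rewrite -lt0n subn_gt0.
  apply: leq_ltn_trans (_ : k < n)%N; first by rewrite -ijk leq_addr.
  by rewrite ltn_neqAle k_neq -ltnS /=.
rewrite subnn expr0 (bigD1 ord_max) //= [X in _ + X]big1 ?addr0; last first.
  move=> i i_neq; apply: big1 => j _.
  rewrite coefC ifF ?mulr0 ?mul0r//; apply/negbTE; rewrite -lt0n subn_gt0.
  by rewrite ltn_neqAle i_neq -ltnS /=.
rewrite (big_pred1 ord0) => [|j]; last by rewrite /= -[X in _ == X]addn0 eqn_add2l.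
by rewrite /= subnn subn0 !bin0 divff ?oner_eq0// coefC eqxx q_n !mul1r mulr1 alg_polyC.
Qed.

End AdditiveConvolution.

(** * The characteristic polynomial of a sum *)

Section Determinant.
Variables (K : comNzRingType) (n : nat).
Implicit Types (A B : 'M[K]_n) (s : 'S_n) (p : {set 'I_n} * {ffun 'I_n -> 'I_n}).

Definition monomial A p : K := \prod_(i in p.1) - A i (p.2 i).

Definition cofactor_term B (u : {set 'I_n} * 'S_n) : {poly K} :=
  (-1) ^+ u.2 * \prod_(i in ~: u.1) char_poly_mx B i (u.2 i).

(** The coefficient of the monomial of [p] in chi_(A+B): up to sign, the minor of
x - B on the rows outside the domain and the columns outside the image of [p]. *)
Definition cofactor_sum B p : {poly K} :=
  \sum_(u in [set u : {set 'I_n} * 'S_n | proper_domain u.1]%SET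
        | partial_perm u.1 u.2 == p) cofactor_term B u.

Lemma char_polyD_perm A B :
  char_poly (A + B) = \sum_(u : {set 'I_n} * 'S_n)
    monomial A (partial_perm u.1 u.2) *: cofactor_term B u.
Proof.
rewrite -(pair_bigA _ (fun I s =>
  monomial A (partial_perm I s) *: cofactor_term B (I, s))) /=.
rewrite exchange_big /char_poly /determinant /=; apply: eq_bigr => s _.
under eq_bigr => i _.
  rewrite (_ : char_poly_mx _ _ _ = (- A i (s i))%:P + char_poly_mx B i (s i));
    last by rewrite !mxE !polyCD !polyCN opprD addrCA.
  over.
rewrite bigA_distr big_distrr /=; apply: eq_bigr => I _.
rewrite /cofactor_term /= -mul_polyC mulrCA; congr (_ * _).
rewrite (bigID (mem I)) /=; congr (_ * _).
  rewrite /monomial rmorph_prod /=; apply: eq_bigr => i iI.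
  by rewrite ffunE !iI.
by apply: eq_big => [i|i /negPf->]; rewrite ?inE.
Qed.

(** The empty domain gives chi_B and the full one gives det (- A); on the others,
permutations with the same restriction carry the same monomial in [A]. *)
Lemma char_polyD A B : (0 < n)%N ->
  char_poly (A + B) = char_poly B + (\det (- A))%:P +
    \sum_(p in proper_partial_perms n) monomial A p *: cofactor_sum B p.
Proof.
move=> n_gt0.
rewrite char_polyD_perm (bigID (fun u => proper_domain u.1)) /= addrC; congr (_ + _).
  have -> : char_poly B = \sum_(s : 'S_n)
      monomial A (partial_perm finset.set0 s) *: cofactor_term B (finset.set0, s).
    apply: eq_bigr => s _; rewrite /monomial /cofactor_term big_set0 scale1r.
    by congr (_ * _); apply: eq_bigl => i; rewrite !inE.
  have -> : (\det (- A))%:P = \sum_(s : 'S_n)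
      monomial A (partial_perm finset.setT s) *: cofactor_term B (finset.setT, s).
    rewrite rmorph_sum; apply: eq_bigr => s _.
    rewrite /monomial /cofactor_term /= finset.setCT big_set0 mulr1 -mul_polyC [RHS]mulrC.
    rewrite rmorphM rmorph_sign; congr (_ * _); rewrite !rmorph_prod.
    by apply: eq_big => [i|i _]; rewrite ?ffunE !inE ?mxE.
  pose F I s := monomial A (partial_perm I s) *: cofactor_term B (I, s).
  (* The empty and the full set are the only improper domains; they differ as
     0 < n. *)
  transitivity (\sum_(I : {set 'I_n} | ~~ proper_domain I) \sum_s F I s).
    by rewrite pair_big /=; apply: eq_big => [[I s]|[I s] _]; rewrite ?andbT.
  have domain0 : ~~ proper_domain (finset.set0 : {set 'I_n}).
    by rewrite /proper_domain cards0.
  have domainT : ~~ proper_domain (finset.setT : {set 'I_n}).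
    by rewrite /proper_domain cardsT card_ord ltnn andbF.
  rewrite (bigD1 finset.set0) //= (bigD1 finset.setT) /=; last first.
    by rewrite domainT -card_gt0 cardsT card_ord.
  rewrite [X in _ + (_ + X)]big1 ?addr0// => I /andP[/andP[+ I_neq0] /negP[]].
  rewrite /proper_domain card_gt0 I_neq0 /= -leqNgt => card_ge.
  by rewrite eqEcard finset.subsetT cardsT card_ord.
transitivity (\sum_(u in [set u : {set 'I_n} * 'S_n | proper_domain u.1]%SET)
    monomial A (partial_perm u.1 u.2) *: cofactor_term B u).
  by apply: eq_bigl => u; rewrite inE.
rewrite (partition_big_imset (fun u => partial_perm u.1 u.2)) /=.
apply: eq_bigr => p _; rewrite scaler_sumr; apply: eq_bigr => u /andP[_ /eqP ->].
by [].
Qed.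

End Determinant.

(** * Finite free position *)

Section FiniteFreePosition.
Variables (R : realType) (n : nat).
Implicit Types (A B : 'M[R[i]]_n) (S T V : set 'M[R[i]]_n).

(** The term subtracted is the contribution of the monomial of [p] in chi_A to
chi_A [+] chi_B, as [cofactor_sum 0 p] is its coefficient in
chi_A = chi_(A + 0). *)
Definition FFP_obstruction B p : {poly R[i]} :=
  cofactor_sum B p - add_conv n (cofactor_sum 0 p) (char_poly B).

(** The terms chi_B and det (- A) occur on both sides of the defining equation and
cancel, so the condition is linear in the monomials of [A], with no constant
term. *)
Lemma add_FFP_monomial A B : (0 < n)%N ->
  add_FFP A B <-> \sum_(p in proper_partial_perms n)
    monomial A p *: FFP_obstruction B p = 0.
Proof.
move=> n_gt0; rewrite /add_FFP.
have -> : char_poly A = 'X^n + (\det (- A))%:P +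
    \sum_(p in proper_partial_perms n) monomial A p *: cofactor_sum 0 p.
  rewrite -[in LHS](addr0 A) char_polyD//.
  rewrite char_poly_trig ?mx0_is_trig//.
  by under eq_bigr => i _ do rewrite mxE subr0; rewrite prodr_const card_ord.
rewrite !add_convD add_conv_Xn ?size_char_poly// add_conv_polyC; last first.
  by have /monicP := char_poly_monic B; rewrite lead_coefE size_char_poly.
rewrite char_polyD// add_conv_sum.
under [X in _ <-> X = 0]eq_bigr => p _ do rewrite scalerBr -add_convZ.
rewrite sumrB; split=> [/addrI->|/eqP]; first exact: subrr.
by rewrite subr_eq0 => /eqP->.
Qed.

Lemma add_FFPC A B : add_FFP A B -> add_FFP B A.
Proof. by rewrite /add_FFP addrC add_convC. Qed.

(** Since finite free position is symmetric, [add_FFP_set] is an order-reversing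
Galois connection of [set 'M_n] with itself, so its image is closed. *)
Lemma add_FFP_affine_algebraicK V :
  add_FF_affine_algebraic V -> generating_set V V.
Proof.
case=> S ->; rewrite /generating_set; apply/seteqP; split=> [B SB A|B SSB A SA].
  by move=> /(_ _ SB) /add_FFPC.
by apply: SSB => C /(_ _ SA) /add_FFPC.
Qed.

Definition monomials A : 'rV[R[i]]_#|proper_partial_perms n| :=
  \row_j monomial A (enum_val j).

Lemma add_FFP_span (s : seq 'M[R[i]]_n) A B : (0 < n)%N ->
  monomials A \in <<map monomials s>>%VS ->
  (forall C, C \in s -> add_FFP C B) -> add_FFP A B.
Proof.
move=> n_gt0 A_span s_FFP.
pose obstruction (v : 'rV[R[i]]_#|proper_partial_perms n|) :=
  \sum_j v 0 j *: FFP_obstruction B (enum_val j).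
have obstruction_linear : linear obstruction.
  move=> a u v; rewrite /obstruction scaler_sumr -big_split /=.
  by apply: eq_bigr => j _; rewrite !mxE scalerDl scalerA.
have obstructionP C : add_FFP C B <-> obstruction (monomials C) = 0.
  rewrite add_FFP_monomial// big_enum_val /obstruction.
  by under [X in _ <-> X = 0]eq_bigr => j _ do rewrite mxE.
apply/obstructionP; apply: linear_eq0_span obstruction_linear _ A_span.
by move=> _ /mapP[C /s_FFP/obstructionP ? ->].
Qed.

Lemma finite_generating_set V : (0 < n)%N -> add_FF_affine_algebraic V ->
  exists s : seq 'M[R[i]]_n,
    (size s <= #|proper_partial_perms n|)%N /\ generating_set V [set` s].
Proof.
move=> n_gt0 V_alg; have [s [s_le sV V_span]] := spanning_subset monomials V.
exists s; split; first by move: s_le; rewrite dimvf /dim /= mul1n.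
rewrite /generating_set [LHS](add_FFP_affine_algebraicK V_alg); congr add_FFP_set.
apply/seteqP; split=> B B_FFP A; first by move=> /sV; apply: B_FFP.
by move=> /V_span /add_FFP_span; apply.
Qed.

(** Only finite generating sets compete for the minimum, since `I_r injects into
every infinite set. *)
Lemma is_ark_le V (s : seq 'M[R[i]]_n) : generating_set V [set` s] ->
  exists r, is_ark V r /\ (r <= size s)%N.
Proof.
move=> s_gen.
pose finite_gen r :=
  `[< exists2 S : set 'M[R[i]]_n, generating_set V S & S #= `I_r >].
have s_image : [set` s] = nth 0 s @` `I_(size s).
  apply/seteqP; split=> [A /= As|_ [j /= j_lt <-] /=]; last exact: mem_nth.
  by exists (index A s); rewrite /= ?index_mem ?nth_index.
have s_card_le : [set` s] #<= `I_(size s) by rewrite s_image card_image_le.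
have /finite_setP[k s_card] : finite_set [set` s].
  exact: card_le_finite s_card_le _.
have gen_k : finite_gen k by apply/asboolP; exists [set` s].
case: (ex_minnP (ex_intro (fun r => is_true (finite_gen r)) k gen_k)).
move=> r /asboolP r_gen r_min.
exists r; split; last first.
  by apply: leq_trans (r_min k gen_k) _; rewrite -card_le_II -(card_le_eql s_card).
split=> // S S_gen; have [/finite_setP[j Sj]|/infiniteP S_inf] := pselect (finite_set S).
  rewrite (card_le_eqr Sj) card_le_II.
  by apply: r_min; apply/asboolP; exists S.
by apply: card_le_trans S_inf; apply: subset_card_le.
Qed.

End FiniteFreePosition.

Theorem proposition3p6 (R : realType) (n : nat) (hn : (1 <= n)%N)
    (V : set 'M[R[i]]_n) (hV : add_FF_affine_algebraic V) :
  exists r : nat,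
    is_ark V r /\ (r <= \sum_(1 <= k < n) k`! * 'C(n, k) ^ 2)%N.
Proof.
have [s [s_le s_gen]] := finite_generating_set hn hV.
have [r [r_ark r_le]] := is_ark_le s_gen.
exists r; split=> //.
exact: leq_trans r_le (leq_trans s_le (card_proper_partial_perms n)).
Qed.
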